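(* Given any positive constant $C$, there exist domains $\Omega$ on the infinite cylinder $\mathbb{S}^1\times\mathbb{R}$ for which $$\lambda_1(\Omega)<\frac{4C\pi}{|\Omega|}.$$ In particular, Pólya's conjecture is not satisfied on the cylindrical strip $\mathcal{C}_h=\mathbb{S}^1\times I_h$ for $h$ larger than $\pi^2/2$.
   Context: $\mathbb{S}^1$ is the unit circle (of length $2\pi$); $\mathbb{S}^1\times\mathbb{R}$ carries the flat product metric; $I_h$ is an open interval of length $h>0$. For a (bounded) domain $\Omega\subset\mathbb{S}^1\times\mathbb{R}$, $|\Omega|$ is its area and $\lambda_1(\Omega)\le\lambda_2(\Omega)\le\cdots$ are the eigenvalues of its Dirichlet Laplacian counted with multiplicity. $\Omega$ satisfies Pólya's conjecture if $\lambda_k(\Omega)\ge4\pi k/|\Omega|$ for all $k\ge1$; for $\mathcal{C}_h$, which has area $2\pi h$, this reads $\lambda_k(\mathcal{C}_h)\ge 2k/h$ for all $k\geq 1$. The Dirichlet eigenvalues of $\mathcal{C}_h$ are the numbers $m^2+n^2\pi^2/h^2$, $m\in\mathbb{Z}$, $n\in\{1,2,\dots\}$. *)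

(* Defs.v *)
From HB Require Import structures.
From mathcomp Require Import all_boot all_order all_algebra.
From mathcomp Require Import all_classical all_reals all_analysis.
Import Order.TTheory GRing.Theory Num.Theory.
Import numFieldNormedType.Exports.
Set Implicit Arguments.
Unset Strict Implicit.
Unset Printing Implicit Defensive.

Local Open Scope classical_set_scope.
Local Open Scope ring_scope.

Section Cylinder.
Context {R : realType}.

Definition unit_circle : set (R * R) := [set p | p.1 ^+ 2 + p.2 ^+ 2 = 1].

Definition cylinder : topologicalType := (set_type unit_circle * R)%type.

Lemma unit_circle_cos_sin (t : R) : (cos t, sin t) \in unit_circle.
Proof. by apply/mem_set; exact: cos2Dsin2. Qed.

(* The locally isometric universal covering of the cylinder by the flat plane.
   All metric notions (smoothness, gradient, area, integrals) are expressed
   through it. *)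
Definition cover_map (t : R * R) : cylinder :=
  (exist _ (cos t.1, sin t.1) (unit_circle_cos_sin t.1), t.2).

Definition bounded_domain (Omega : set cylinder) : Prop :=
  [/\ open Omega, connected Omega, Omega !=set0
    & exists M : R, forall p, Omega p -> `|p.2| <= M].

Definition strip (I : set R) : set cylinder := [set p | I p.2].

(* The copy of Omega in the fundamental domain [0, 2 pi) x R of [cover_map]. *)
Definition fund_patch (Omega : set cylinder) : set (R * R) :=
  [set t | 0 <= t.1 < 2 * pi /\ Omega (cover_map t)].

Definition leb2 :
    {measure set (measurableTypeR R * measurableTypeR R) -> \bar R} :=
  (lebesgue_measure \x lebesgue_measure)%E.

Definition area (Omega : set cylinder) : \bar R := leb2 (fund_patch Omega).

Definition ae_zero (Omega : set cylinder) (u : cylinder -> R) : Prop :=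
  {ae leb2, forall t, fund_patch Omega t -> u (cover_map t) = 0}.

Fixpoint Ck (k : nat) (f : R * R -> R) : Prop :=
  continuous f /\
  if k is j.+1 then
    (forall z, derivable f z (1, 0) /\ derivable f z (0, 1)) /\
    Ck j ('D_(1, 0) f) /\ Ck j ('D_(0, 1) f)
  else True.

(* The space of test functions C_c^oo(Omega). *)
Definition test_function (Omega : set cylinder) (phi : cylinder -> R) : Prop :=
  (forall k, Ck k (phi \o cover_map)) /\
  exists K : set cylinder,
    [/\ compact K, K `<=` Omega & forall p, ~ K p -> phi p = 0].

(* The components of the gradient, in the coordinates given by [cover_map]. *)
Definition dx (phi : cylinder -> R) : R * R -> R :=
  'D_(1, 0) (phi \o cover_map).
Definition dy (phi : cylinder -> R) : R * R -> R :=
  'D_(0, 1) (phi \o cover_map).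

Definition L2 (Omega : set cylinder) (f : R * R -> R) : Prop :=
  measurable_fun (fund_patch Omega) f /\
  (\int[leb2]_(t in fund_patch Omega) ((f t) ^+ 2)%:E < +oo)%E.

Definition L2_cvg (Omega : set cylinder) (f : nat -> R * R -> R)
    (g : R * R -> R) : Prop :=
  (fun n => \int[leb2]_(t in fund_patch Omega) ((f n t - g t) ^+ 2)%:E)%E
    @ \oo --> (0 : \bar R)%E.

(* u belongs to H^1_0(Omega), the closure of C_c^oo(Omega) in H^1(Omega), and
   (gx, gy) is its weak gradient (determined a.e. by u). *)
Definition H10 (Omega : set cylinder) (u : cylinder -> R)
    (gx gy : R * R -> R) : Prop :=
  [/\ L2 Omega (u \o cover_map), L2 Omega gx, L2 Omega gy
    & exists phi : nat -> cylinder -> R,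
      [/\ forall n, test_function Omega (phi n),
          L2_cvg Omega (fun n => phi n \o cover_map) (u \o cover_map),
          L2_cvg Omega (fun n => dx (phi n)) gx
        & L2_cvg Omega (fun n => dy (phi n)) gy]].

(* Graph of the Dirichlet Laplacian, with the sign making it nonnegative: the
   self-adjoint operator on L^2(Omega) associated with the Dirichlet form on
   H^1_0(Omega). *)
Definition dirichlet_laplacian (Omega : set cylinder) (u f : cylinder -> R)
    : Prop :=
  L2 Omega (f \o cover_map) /\
  exists gx gy : R * R -> R, H10 Omega u gx gy /\
    forall phi, test_function Omega phi ->
      \int[leb2]_(t in fund_patch Omega) (gx t * dx phi t + gy t * dy phi t) =
      \int[leb2]_(t in fund_patch Omega) (f (cover_map t) * phi (cover_map t)).

Definition dirichlet_eigenspace (Omega : set cylinder) (l : R)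
    : set (cylinder -> R) :=
  [set u | dirichlet_laplacian Omega u (fun p => l * u p)].

Definition lin_indep (Omega : set cylinder) (k : nat)
    (u : 'I_k -> cylinder -> R) : Prop :=
  forall c : 'I_k -> R,
    ae_zero Omega (fun p => \sum_(i < k) c i * u i p) -> forall i, c i = 0.

(* The k-th Dirichlet eigenvalue counted with multiplicity, k >= 1: the least l
   such that the eigenvalues <= l have total multiplicity >= k.  The infimum is
   taken in \bar R so that it is +oo, and not 0, if there is no such l. *)
Definition dirichlet_eigenvalue (Omega : set cylinder) (k : nat) : \bar R :=
  ereal_inf [set l%:E | l in [set l : R |
    exists (m : 'I_k -> R) (u : 'I_k -> cylinder -> R),
      (forall i, m i <= l /\ dirichlet_eigenspace Omega (m i) (u i)) /\
      lin_indep Omega u]].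

Definition satisfies_polya (Omega : set cylinder) : Prop :=
  forall k : nat, (0 < k)%N ->
    ((4 * pi * k%:R / fine (area Omega))%:E <= dirichlet_eigenvalue Omega k)%E.

End Cylinder.

Arguments cylinder : clear implicits.

(* Main.v *)
(* On the strip of height h, sin (pi (y - a) / h) is a Dirichlet eigenfunction
   for the eigenvalue pi^2 / h^2, so lambda_1 <= pi^2 / h^2, whereas the area is
   2 pi h.  Hence lambda_1 < 4 C pi / area = 2 C / h when h > pi^2 / (2 C).
   Membership in H^1_0 is witnessed by multiplying the sine by the cut-offs
   exp (-1 / (n d - 1)), d the distance to either end: because the sine vanishes
   linearly at the ends, the gradients of the products stay uniformly bounded
   and dominated convergence applies. *)
Require Import Defs.
From mathcomp Require Import all_boot all_order all_algebra.
From mathcomp Require Import all_classical all_reals all_analysis.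
From mathcomp Require Import measurable_realfun ring lra.
Import Order.TTheory GRing.Theory Num.Theory.
Import numFieldNormedType.Exports.
Local Open Scope classical_set_scope.
Local Open Scope ring_scope.

(** * Iterated derivability on the line *)

(** Each derivative is a named witness, so closure properties follow by induction on the order with
    explicit formulas. *)
Fixpoint iter_derivable {R : realType} (n : nat) (f : R -> R) : Prop :=
  if n is m.+1 then
    exists df : R -> R,
      (forall x : R, is_derive x 1 f (df x)) /\ iter_derivable m df
  else True.

Lemma iter_derivableS {R : realType} n (f : R -> R) :
  iter_derivable n.+1 f -> iter_derivable n f.
Proof.
elim: n f => [//|n IHn] f [df [fdf sdf]].
by exists df; split => //; exact: IHn.
Qed.

Lemma iter_derivable_cst {R : realType} n (c : R) :
  iter_derivable n (fun _ : R => c).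
Proof.
elim: n c => [//|n IHn] c; exists (fun=> 0); split => // x.
exact: is_derive_cst.
Qed.

Lemma iter_derivableD {R : realType} n (f g : R -> R) :
  iter_derivable n f -> iter_derivable n g ->
  iter_derivable n (fun x => f x + g x).
Proof.
elim: n f g => [//|n IHn] f g [df [fdf sdf]] [dg [gdg sdg]].
exists (fun x => df x + dg x); split; last exact: IHn.
by move=> x; exact: is_deriveD.
Qed.

Lemma iter_derivableM {R : realType} n (f g : R -> R) :
  iter_derivable n f -> iter_derivable n g ->
  iter_derivable n (fun x => f x * g x).
Proof.
elim: n f g => [//|n IHn] f g sf sg.
(* The product rule keeps [f] and [g] themselves next to their derivatives, so both are also needed
   at the lower order. *)
have sf' := iter_derivableS _ _ sf; have sg' := iter_derivableS _ _ sg.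
case: sf sg => [df [fdf sdf]] [dg [gdg sdg]].
exists (fun x => f x * dg x + g x * df x); split.
  by move=> x; exact: is_deriveM.
by apply: iter_derivableD; exact: IHn.
Qed.

Lemma is_derive_affine {R : realType} (a b : R) (x : R) :
  is_derive x 1 (fun y => a * y + b) a.
Proof.
have h1 : is_derive x 1 (fun y : R => a * y) a.
  have := @is_deriveZ _ _ _ (@id R) a x 1 1 (is_derive_id _ _).
  by rewrite scaler1.
have := @is_deriveD _ _ _ _ _ _ _ _ _ h1 (is_derive_cst b x 1).
by rewrite addr0.
Qed.

Lemma iter_derivable_affine {R : realType} n (a b : R) (f : R -> R) :
  iter_derivable n f -> iter_derivable n (fun x => f (a * x + b)).
Proof.
elim: n f => [//|n IHn] f [df [fdf sdf]].
exists (fun x => df (a * x + b) * a); split.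
  move=> x; exact: (is_derive1_comp (fdf _) (is_derive_affine a b x)).
apply: iter_derivableM; [exact: IHn|exact: iter_derivable_cst].
Qed.

Lemma iter_derivable_sin {R : realType} n : iter_derivable n (@sin R).
Proof.
(* Sine and cosine differentiate into each other up to sign, so the induction carries both. *)
suff [] : iter_derivable n (@sin R) /\ iter_derivable n (@cos R) by [].
elim: n => [//|n [IHs IHc]]; split.
  by exists cos; split => // x; exact: is_derive_sin.
exists (fun x => -1 * sin x); split; last first.
  by apply: iter_derivableM => //; exact: iter_derivable_cst.
by move=> x; rewrite mulN1r; exact: is_derive_cos.
Qed.

(** * The flat function and its derivatives *)

(* [flat 0] is the classical smooth function vanishing on the negative
   half-line; the powers of the inverse close the family under derivation. *)
Definition flat {R : realType} (k : nat) (t : R) : R :=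
  if 0 < t then t ^- k * expR (- t^-1) else 0.

Lemma flat_ge0 {R : realType} k (t : R) : 0 <= flat k t.
Proof.
rewrite /flat; case: ifPn => // t0.
by rewrite mulr_ge0 ?expR_ge0// invr_ge0 exprn_ge0// ltW.
Qed.

(** With [x = t^-1] this is the exponential series bound [x ^+ k / k! <= expR x]. *)
Lemma flat_le_fact {R : realType} k (t : R) : flat k t <= k`!%:R.
Proof.
rewrite /flat; case: ifPn => // t0.
rewrite expRN ler_pdivrMr ?expR_gt0// -exprVn.
have := t0; rewrite -invr_gt0; move: t^-1 => x x0.
case: k => [|k]; first by rewrite expr0 mul1r -[leLHS]expR0 ler_expR ltW.
rewrite mulrC -ler_pdivrMr ?ltr0n ?fact_gt0//.
by apply: le_trans (expR_ge1Dxn k (ltW x0)); rewrite lerDr.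
Qed.

(** Trades powers of [t] for a higher index. This yields the derivative at 0 and later absorbs the
    large factors produced by differentiating the cut-offs. *)
Lemma flat_shift {R : realType} k j (t : R) :
  flat k t = t ^+ j * flat (k + j) t.
Proof.
rewrite /flat; case: ifPn => [t0|]; last by rewrite mulr0.
by rewrite mulrA exprD invfM mulrCA divff ?mulr1// expf_neq0// gt_eqF.
Qed.

Lemma is_derive_flat {R : realType} k (t : R) :
  is_derive t 1 (flat k) (flat k.+2 t - k%:R * flat k.+1 t).
Proof.
have [t0|t0|->] := ltgtP t 0.
- rewrite /flat !ltNge (ltW t0)/= mulr0 subr0.
  apply: (near_eq_is_derive _ (is_derive_cst (0 : R) t 1)).
  near=> s; rewrite /= ifF//; apply/negbTE; rewrite -leNgt ltW//.
  by near: s; exact: lt_nbhsl.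
- have dV : is_derive t 1 (fun s : R => s^-1) (- t ^- 2).
    have t_neq0 : id t != 0 by rewrite gt_eqF.
    by have := is_deriveV t_neq0 (is_derive_id t 1); rewrite scaler1.
  have dX : is_derive t 1 (fun s : R => s^-1 ^+ k)
      (k%:R * t^-1 ^+ k.-1 * - t ^- 2).
    have := @is_deriveX _ _ _ k _ _ _ dV.
    congr is_derive; apply/funext => s.
    by elim: k => // k IHk; rewrite !exprS -IHk.
  have dN : is_derive t 1 (fun s : R => - s^-1) (t ^- 2).
    by have := is_deriveN dV; rewrite opprK.
  have dE := @is_derive1_comp _ expR _ _ _ _ (is_derive_expR _) dN.
  have dM := is_deriveM dX dE.
  apply: (@near_eq_is_derive _ _ _
    ((fun s => s^-1 ^+ k) * (fun s => expR (- s^-1)))).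
    near=> s; rewrite /flat ifT; first by rewrite -exprVn.
    by near: s; exact: lt_nbhsr.
  apply: is_derive_eq.
  rewrite /flat t0 -!exprVn /GRing.scale/=.
  case: k {dX dM} => [|k]; rewrite /= ?exprS; ring.
(* At 0 the difference quotient is [h * flat (k + 2) h] by [flat_shift], hence at most [|h|] times a
   factorial. *)
- rewrite /flat ltxx mulr0 subr0 -/(flat k).
  suff cv : h^-1 *: (flat k (h *: 1 + 0) - flat k 0) @[h --> (0:R)^'] --> (0:R).
    by apply: DeriveDef; [apply/cvg_ex; exists 0|exact/cvg_lim].
  apply/cvgr0Pnorm_lt => e e0; near=> h.
  rewrite {2}/flat ltxx subr0 addr0 scaler1.
  have h0 : h != 0 by near: h; exact: nbhs_dnbhs_neq.
  rewrite normrZ normfV (flat_shift k 2) normrM normrX expr2 mulrA mulrA.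
  rewrite mulVf ?normr_eq0// mul1r (ger0_norm (flat_ge0 _ _)).
  apply: (@le_lt_trans _ _ (`|h| * (k + 2)`!%:R)).
    by rewrite ler_wpM2l// flat_le_fact.
  rewrite -ltr_pdivlMr ?ltr0n ?fact_gt0//.
  near: h; apply: dnbhs0_lt; rewrite divr_gt0// ltr0n fact_gt0.
Unshelve. all: by end_near. Qed.

Lemma iter_derivable_flat {R : realType} n k : iter_derivable n (@flat R k).
Proof.
elim: n k => [//|n IHn] k.
exists (fun x => flat k.+2 x + - k%:R * flat k.+1 x); split.
  by move=> x; rewrite mulNr; exact: is_derive_flat.
apply: iter_derivableD => //; apply: iter_derivableM => //.
exact: iter_derivable_cst.
Qed.

(** * Functions of the axial coordinate alone *)

Lemma growth_rate_snd {R : realType} (f : R * R -> R) (z : R * R) :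
  (fun h : R => h^-1 *: (f (h *: (0, 1) + z) - f z)) =
  (fun h : R => h^-1 *: (f (z.1, h *: 1 + z.2) - f (z.1, z.2))).
Proof.
apply/funext => h; case: z => x y; congr (_ *: (f _ - _)).
by congr pair; rewrite /= scaler0 add0r.
Qed.

(** The two difference quotients are the same function of [h]. This reduces axial derivatives to
    calculus on a vertical line. *)
Lemma is_derive_snd {R : realType} (f : R * R -> R) (z : R * R) (df : R) :
  is_derive z (0, 1) f df <-> is_derive z.2 1 (fun y => f (z.1, y)) df.
Proof.
have e := growth_rate_snd f z.
split=> -[d1 d2]; apply: DeriveDef.
- by move: d1; rewrite /derivable e.
- by move: d2; rewrite /derive e.
- by move: d1; rewrite /derivable -e.
- by move: d2; rewrite /derive -e.
Qed.

Lemma is_derive_fst_comp_snd {R : realType} (g : R -> R) (z : R * R) :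
  is_derive z (1, 0) (g \o snd) 0.
Proof.
have e : (fun h : R =>
    h^-1 *: ((g \o snd) (h *: (1, 0) + z) - (g \o snd) z)) = cst 0.
  by apply/funext => h; rewrite /= scaler0 add0r subrr scaler0.
apply: DeriveDef; rewrite /derivable /derive e; first exact: is_cvg_cst.
exact: lim_cst.
Qed.

Lemma continuous_comp_snd {R : realType} (g dg : R -> R) :
  (forall y : R, is_derive y 1 g (dg y)) -> continuous (g \o snd : R * R -> R).
Proof.
move=> gdg z; apply: continuous_comp; first exact: cvg_snd.
by apply/differentiable_continuous/derivable1_diffP; have [] := gdg z.2.
Qed.

Lemma Ck_comp_snd {R : realType} (k : nat) (g : R -> R) :
  (forall n, iter_derivable n g) -> Ck k (g \o snd).
Proof.
(* One order more than [k] is required because continuity of the last derivative is deduced from its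
   derivability. *)
move=> /(_ k.+1); elim: k g => [|k IHk] g [dg [gdg sdg]].
  by split; first exact: continuous_comp_snd gdg.
split; last split; last split.
- exact: continuous_comp_snd gdg.
- move=> z; split; first by have [] := is_derive_fst_comp_snd g z.
  by have [] := (is_derive_snd (g \o snd) z _).2 (gdg z.2).
- rewrite (_ : 'D_(1, 0) (g \o snd : R * R -> R) = (fun=> 0) \o snd).
    by apply: IHk; exact: iter_derivable_cst.
  by apply/funext => z; apply/derive_val; exact: is_derive_fst_comp_snd.
- rewrite (_ : 'D_(0, 1) (g \o snd : R * R -> R) = dg \o snd); first exact: IHk.
  by apply/funext => z; apply/derive_val/(is_derive_snd (g \o snd) z _).2.
Qed.

(** * The covering map *)

(** The angle is [acos x] on the upper half-circle and [2 * pi - acos x] on the lower one. *)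
Lemma unit_circle_surj {R : realType} (x y : R) : x ^+ 2 + y ^+ 2 = 1 ->
  exists2 t, t \in `[0, 2 * pi] & x = cos t /\ y = sin t.
Proof.
move=> xy1.
have x2 : x ^+ 2 <= 1 by rewrite -xy1 lerDl sqr_ge0.
have x1 : -1 <= x <= 1.
  rewrite -ler_norml -(@ler_pXn2r _ 2)// ?nnegrE//.
  by rewrite expr1n real_normK// num_real.
have sE : sin (acos x) = `|y| by rewrite sin_acos// -xy1 addrC addKr sqrtr_sqr.
have a0 := acos_ge0 x1; have api := acos_lepi x1.
have cE : cos (acos x) = x by rewrite acosK// in_itv.
have [y0|y0] := leP 0 y.
  exists (acos x); last by rewrite cE sE ger0_norm.
  by rewrite in_itv/= a0/= (le_trans api)// ler_peMl ?pi_ge0// ler1n.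
exists (2 * pi - acos x).
  rewrite in_itv/= gerBl a0 andbT subr_ge0 (le_trans api)//.
  by rewrite ler_peMl ?pi_ge0// ler1n.
by rewrite mulr_natl addrC cosD2pi sinD2pi cosN sinN cE sE ltr0_norm// opprK.
Qed.

Lemma cover_map_continuous {R : realType} : continuous (@cover_map R).
Proof.
pose c (t : R * R) : set_type (@unit_circle R) :=
  exist _ (cos t.1, sin t.1) (unit_circle_cos_sin t.1).
have cc : continuous c.
  (* The circle carries the topology induced from the plane, so it suffices to check both
     coordinates. *)
  apply: continuous_comp_initial => s.
  have ccos : (fun t : R * R => cos t.1) t @[t --> s] --> cos s.1.
    apply: (@continuous_comp _ _ _ fst cos); first exact: cvg_fst.
    exact: continuous_cos.
  have csin : (fun t : R * R => sin t.1) t @[t --> s] --> sin s.1.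
    apply: (@continuous_comp _ _ _ fst sin); first exact: cvg_fst.
    exact: continuous_sin.
  exact: (cvg_pair ccos csin).
move=> t.
have csnd : snd x @[x --> t] --> t.2 by exact: cvg_snd.
exact: (cvg_pair (cc t) csnd).
Qed.

(** The closed interval of angles lets compact subsets of the cylinder be obtained as images of
    closed rectangles. *)
Lemma cover_map_surj {R : realType} (p : cylinder R) :
  exists2 x, x \in `[0, 2 * pi] & cover_map (x, p.2) = p.
Proof.
case: p => [[[x y] xy] z]/=.
have /set_mem/unit_circle_surj[t tI [xE yE]] := xy.
by exists t => //; congr pair; apply: eq_exist; move: xE yE => /= -> ->.
Qed.

(** * Measure and integration on the fundamental patch *)

(** An open set of the plane is a countable union of boxes with rational centres and radii
    [1 / (n + 1)], each a measurable rectangle. *)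
Lemma open_prod_measurable {R : realType} (U : set (R * R)) :
  open U -> measurable (U : set (measurableTypeR R * measurableTypeR R)).
Proof.
move=> oU.
pose box (q : rat * rat * nat) : set (measurableTypeR R * measurableTypeR R) :=
  ball (ratr q.1.1 : R) q.2.+1%:R^-1 `*` ball (ratr q.1.2 : R) q.2.+1%:R^-1.
pose F q := if `[< box q `<=` U >] then box q else set0.
have -> : U = \bigcup_q F q.
  apply/seteqP; split=> [[x y] Uxy|z [q _]]; last first.
    by rewrite /F; case: asboolP => // qU; exact: qU.
  have /nbhs_ballP[e /= e0 eU] : nbhs (x, y) U by exact: open_nbhs_nbhs.
  (* Radii below [e / 2] suffice: a point of the box and [x] are each within one radius of the
     rational centre. *)
  have e20 : 0 < e / 2 by rewrite divr_gt0.
  have [n _ /(_ n (leqnn n)) /= ne] := near_infty_natSinv_lt (PosNum e20).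
  have near_rat (w : R) : exists q : rat, `|ratr q - w| < n.+1%:R^-1.
    have [|q] := @rat_in_itvoo _ (w - n.+1%:R^-1) (w + n.+1%:R^-1).
      by rewrite ltrD2l gtrN.
    by rewrite in_itv/= => wq; exists q; rewrite ltr_distl.
  have [p px] := near_rat x; have [q qy] := near_rat y.
  have boxU : box (p, q, n) `<=` U.
    move=> [x' y'] [/= px' qy']; apply: eU; split=> /=.
      rewrite /ball/= (splitr e); apply: le_lt_trans (ler_distD (ratr p) _ _) _.
      by rewrite ltrD// (lt_trans _ ne)// distrC.
    rewrite /ball/= (splitr e); apply: le_lt_trans (ler_distD (ratr q) _ _) _.
    by rewrite ltrD// (lt_trans _ ne)// distrC.
  by exists (p, q, n) => //; rewrite /F asboolT.
apply: countable_bigcupT_measurable => // q; rewrite /F; case: ifP => // _.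
by apply: measurableX; exact: measurable_ball.
Qed.

Lemma continuous_measurable_fun2 {R : realType} (f : R * R -> R) :
  continuous f ->
  measurable_fun setT (f : measurableTypeR R * measurableTypeR R -> R).
Proof.
move=> /continuousP cf.
apply: (measurability _ (RGenOpens.measurableE R)).
move=> _ [_ [a [b ->] <-]]; rewrite setTI; apply: open_prod_measurable.
exact/cf/interval_open.
Qed.

Lemma fund_patch_strip {R : realType} (a b : R) :
  fund_patch (strip `]a, b[) = `[0, 2 * pi[ `*` `]a, b[.
Proof.
by apply/seteqP; split=> -[x y] /=; rewrite /fund_patch /strip /= !in_itv/=.
Qed.

Lemma measurable_rectangle {R : realType} (i j : interval R) :
  measurable ([set` i] `*` [set` j] :
    set (measurableTypeR R * measurableTypeR R)).
Proof. by apply: measurableX; exact: measurable_itv. Qed.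

Lemma leb2_patch {R : realType} (a b : R) : a < b ->
  leb2 (`[0, 2 * pi[ `*` `]a, b[) = (2 * pi * (b - a))%:E.
Proof.
move=> ab; transitivity ((lebesgue_measure (`[0, 2 * pi[%classic : set R)%R *
    lebesgue_measure (`]a, b[%classic : set R))%E : \bar R).
  by apply: product_measure1E; exact: measurable_itv.
rewrite !lebesgue_measure_itv/= !lte_fin mulr_gt0 ?pi_gt0// ab oppr0 adde0.
by rewrite -EFinB -EFinM.
Qed.

(** The patch lies in a closed rectangle, whose continuous image is compact. *)
Lemma continuous_bounded_patch {R : realType} (a b : R) (f : R * R -> R) :
  continuous f ->
  exists M, forall t, (`[0, 2 * pi[ `*` `]a, b[) t -> `|f t| <= M.
Proof.
move=> cf.
have cK : compact (`[0, 2 * pi] `*` `[a, b] : set (R * R)).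
  by apply: compact_setX; exact: segment_compact.
have : compact (f @` (`[0, 2 * pi] `*` `[a, b])).
  by apply: continuous_compact => //; exact: continuous_subspaceT.
move=> /compact_bounded[M [_ /(_ (M + 1))]]; rewrite ltrDl ltr01 => /(_ isT) fM.
exists (M + 1) => -[x y] [/= xI yI]; apply: fM.
exists (x, y) => //; split => /=.
  exact: subset_itv_co_cc xI.
exact: subset_itv_oo_cc yI.
Qed.

Lemma continuous_integrable_patch {R : realType} (a b : R) (f : R * R -> R) :
  a < b -> continuous f ->
  leb2.-integrable (`[0, 2 * pi[ `*` `]a, b[) (EFin \o f).
Proof.
move=> ab cf; apply: measurable_bounded_integrable.
- exact: measurable_rectangle.
- by rewrite leb2_patch// ltry.
- by apply: measurable_funTS; exact: continuous_measurable_fun2.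
- have [M fM] := continuous_bounded_patch a b f cf.
  exists M; split; first exact: num_real.
  by move=> N MN t /fM/le_trans; apply; exact: ltW.
Qed.

Lemma continuous_L2_strip {R : realType} (a b : R) (f : R * R -> R) :
  a < b -> continuous f -> L2 (strip `]a, b[) f.
Proof.
move=> ab cf; rewrite /L2 fund_patch_strip; split.
  by apply: measurable_funTS; exact: continuous_measurable_fun2.
have cf2 : continuous (fun t => f t ^+ 2).
  move=> t; apply: (@continuous_comp _ _ _ f (fun x => x ^+ 2)).
    exact: cf.
  exact: exprn_continuous.
have /integrableP[_] := continuous_integrable_patch a b _ ab cf2.
congr (_ < _)%E; apply: eq_integral => t _ /=.
by rewrite ger0_norm// sqr_ge0.
Qed.

(** Dominated convergence with the constant [(M + N) ^+ 2], where [N] bounds [g]; constants are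
    integrable since the patch has finite area. *)
Lemma L2_cvg_dominated {R : realType} (a b M : R) (f : nat -> R * R -> R)
    (g : R * R -> R) :
  a < b -> (forall n, continuous (f n)) -> continuous g ->
  (forall n t, (`[0, 2 * pi[ `*` `]a, b[) t -> `|f n t| <= M) ->
  (forall t, (`[0, 2 * pi[ `*` `]a, b[) t -> f n t @[n --> \oo] --> g t) ->
  L2_cvg (strip `]a, b[) f g.
Proof.
move=> ab cf cg fM fg; rewrite /L2_cvg fund_patch_strip.
have [N gN] := continuous_bounded_patch a b g cg.
set D := `[0, 2 * pi[ `*` `]a, b[.
have mD : measurable (D : set (measurableTypeR R * measurableTypeR R)).
  exact: measurable_rectangle.
have sub_sqr_cont (u v : R * R -> R) : continuous u -> continuous v ->
    continuous (fun t => (u t - v t) ^+ 2).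
  move=> cu cv t.
  apply: (@continuous_comp _ _ _ (u - v) (fun x => x ^+ 2)).
    by apply: continuousB; [exact: cu|exact: cv].
  exact: exprn_continuous.
have ftoo : (leb2 D < +oo)%E by rewrite leb2_patch// ltry.
have [|||||_ _] := @dominated_convergence _ _ _ (@leb2 R) D mD
  (fun n t => ((f n t - g t) ^+ 2)%:E) (cst 0%E) (cst (((M + N) ^+ 2)%:E)).
- move=> n; apply/measurable_EFinP; apply: measurable_funTS.
  by apply: continuous_measurable_fun2; exact: sub_sqr_cont.
- exact: measurable_cst.
- apply: aeW => t Dt.
  apply: cvg_EFin; first exact: nearW.
  have -> : 0 = (g t - g t) ^+ 2 by rewrite subrr expr0n.
  apply: (@cvg_comp _ _ _ (fun n => f n t - g t) (fun x => x ^+ 2));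
    last exact: exprn_continuous.
  by apply: cvgB; [exact: fg|exact: cvg_cst].
- apply: continuous_integrable_patch ab _; exact: cst_continuous.
- apply: aeW => t n Dt; rewrite /= lee_fin ger0_norm ?sqr_ge0//.
  have fgMN : `|f n t - g t| <= M + N.
    by rewrite (le_trans (ler_normB _ _))// lerD ?fM ?gN.
  rewrite -real_normK ?num_real// ler_pXn2r ?nnegrE//.
  exact: le_trans fgMN.
by rewrite integral_cst// mul0e.
Qed.

(** * Cut-off approximations of the sine *)

Lemma sin_le_id {R : realType} (x : R) : 0 <= x -> sin x <= x.
Proof.
move=> x0.
have [|c _] := @MVT_segment _ sin cos 0 x x0 (fun y _ => is_derive_sin y).
  by apply: continuous_subspaceT => y; exact: continuous_sin.
by rewrite sin0 !subr0 => ->; rewrite ler_piMl// cos_le1.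
Qed.

(** Writing the limit as [0 ^+ k] covers two uses at once: the cut-offs tend to 1 ([k = 0]), the
    terms from their derivatives to 0 ([k > 0]). *)
Lemma cvg_flat {R : realType} (k : nat) (s : nat -> R) :
  s n @[n --> \oo] --> +oo -> flat k (s n) @[n --> \oo] --> (0 : R) ^+ k.
Proof.
move=> soo.
have s0 : \forall n \near \oo, 0 < s n by move/cvgryPgt : soo; exact.
have sV : (s n)^-1 @[n --> \oo] --> (0 : R) by apply/gtr0_cvgV0.
have -> : (0 : R) ^+ k = 0 ^+ k * expR (- 0) by rewrite oppr0 expR0 mulr1.
have cM : (s n)^-1 ^+ k * expR (- (s n)^-1) @[n --> \oo] -->
    (0 : R) ^+ k * expR (- 0).
  apply: cvgM.
    exact: (cvg_comp _ (fun x => x ^+ k) sV (@exprn_continuous _ k _)).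
  exact: (cvg_comp _ expR (cvgN sV) (@continuous_expR _ _)).
apply: cvg_trans cM; apply: near_eq_cvg.
by near do rewrite /flat exprVn ifT//.
Unshelve. all: by end_near. Qed.

Section sin_bump.
Context {R : realType} (a b : R).
Hypothesis ab : a < b.

(** The lowest positive frequency at which the sine vanishes at both ends; its square is the
    eigenvalue. *)
Definition freq : R := pi / (b - a).

(* The factor [flat 0 (n.+1 * d - 1)] vanishes when the distance [d] to an
   endpoint is at most [1 / n.+1]. *)
Definition sin_bump (n : nat) (y : R) : R :=
  sin (freq * (y - a)) *
    (flat 0 (n.+1%:R * (y - a) - 1) * flat 0 (n.+1%:R * (b - y) - 1)).

(** The product rule applied to [sin_bump n]: the derivative of [flat 0] is [flat 2], and the chain
    rule gives the factors [n.+1] with opposite signs. *)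
Definition dsin_bump (n : nat) (y : R) : R :=
  freq * cos (freq * (y - a)) *
    (flat 0 (n.+1%:R * (y - a) - 1) * flat 0 (n.+1%:R * (b - y) - 1)) +
  sin (freq * (y - a)) *
    (n.+1%:R * flat 2 (n.+1%:R * (y - a) - 1) * flat 0 (n.+1%:R * (b - y) - 1) -
     flat 0 (n.+1%:R * (y - a) - 1) *
       (n.+1%:R * flat 2 (n.+1%:R * (b - y) - 1))).

Lemma freq_gt0 : 0 < freq.
Proof. by rewrite divr_gt0 ?pi_gt0// subr_gt0. Qed.

Let is_derive_arg (y : R) : is_derive y 1 (fun y => freq * (y - a)) freq.
Proof.
have := is_derive_affine freq (- (freq * a)) y.
by congr is_derive; apply/funext => z; rewrite mulrBr.
Qed.

Lemma is_derive_sin_freq (y : R) :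
  is_derive y 1 (fun y => sin (freq * (y - a))) (freq * cos (freq * (y - a))).
Proof.
rewrite mulrC.
exact: (@is_derive1_comp _ sin _ y _ _ (is_derive_sin _) (is_derive_arg y)).
Qed.

Lemma is_derive_cos_freq (y : R) :
  is_derive y 1 (fun y => freq * cos (freq * (y - a)))
    (- (freq ^+ 2 * sin (freq * (y - a)))).
Proof.
have h := @is_derive1_comp _ cos _ y _ _ (is_derive_cos _) (is_derive_arg y).
have := @is_deriveZ _ _ _ _ freq _ _ _ h.
by congr is_derive; rewrite /GRing.scale/=; ring.
Qed.

Lemma is_derive_sin_bump n (y : R) : is_derive y 1 (sin_bump n) (dsin_bump n y).
Proof.
have e1 : is_derive y 1 (fun y => n.+1%:R * (y - a) - 1) n.+1%:R.
  have := is_derive_affine n.+1%:R (- (n.+1%:R * a) - 1) y.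
  by congr is_derive; apply/funext => z; ring.
have e2 : is_derive y 1 (fun y => n.+1%:R * (b - y) - 1) (- n.+1%:R).
  have := is_derive_affine (- n.+1%:R) (n.+1%:R * b - 1) y.
  by congr is_derive; apply/funext => z; ring.
have d1 := @is_derive1_comp _ (flat 0) _ y _ _ (is_derive_flat _ _) e1.
have d2 := @is_derive1_comp _ (flat 0) _ y _ _ (is_derive_flat _ _) e2.
have := is_deriveM (is_derive_sin_freq y) (is_deriveM d1 d2).
by congr is_derive; rewrite /dsin_bump /GRing.scale/= mulrfctE/=; ring.
Qed.

Lemma iter_derivable_sin_bump n k : iter_derivable n (sin_bump k).
Proof.
apply: iter_derivableM; last apply: iter_derivableM.
- have := iter_derivable_affine n freq (- (freq * a)) _ (iter_derivable_sin n).
  by congr iter_derivable; apply/funext => y; rewrite mulrBr.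
- have := iter_derivable_affine n k.+1%:R (- (k.+1%:R * a) - 1) _
    (iter_derivable_flat n 0).
  by congr iter_derivable; apply/funext => y; congr flat; ring.
- have := iter_derivable_affine n (- k.+1%:R) (k.+1%:R * b - 1) _
    (iter_derivable_flat n 0).
  by congr iter_derivable; apply/funext => y; congr flat; ring.
Qed.

(** The distance to [b] is handled through the symmetry of the sine about the midpoint,
    [sin x = sin (pi - x)]. *)
Lemma sin_freq_bounds (y : R) : y \in `]a, b[ ->
  [/\ 0 < sin (freq * (y - a)), sin (freq * (y - a)) <= freq * (y - a)
    & sin (freq * (y - a)) <= freq * (b - y)].
Proof.
rewrite in_itv/= => /andP[ay yb].
have yE : freq * (b - y) = pi - freq * (y - a).
  have ba : b - a != 0 by rewrite subr_eq0 gt_eqF.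
  by rewrite /freq; field.
have ya0 : 0 < freq * (y - a) by rewrite mulr_gt0 ?freq_gt0// subr_gt0.
have by0 : 0 < freq * (b - y) by rewrite mulr_gt0 ?freq_gt0// subr_gt0.
split; first by rewrite sin_gt0_pi// ya0/= -subr_gt0 -yE.
  exact/sin_le_id/ltW.
rewrite -[leLHS]opprK -sinN -sinDpi addrC -yE.
exact/sin_le_id/ltW.
Qed.

Lemma sin_bump_bound n (y : R) : `|sin_bump n y| <= 1.
Proof.
rewrite /sin_bump normrM mulr_ile1// ?sin_max// normrM.
by rewrite !ger0_norm ?flat_ge0// mulr_ile1// ?flat_ge0// (flat_le_fact 0).
Qed.

(* The derivative of the cut-off is of the order of [c], but the sine is small
   where that derivative is supported. *)
Lemma scaled_flat_bound (c d r : R) : 0 <= c -> 0 <= d -> 0 <= r <= freq * d ->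
  r * (c * flat 2 (c * d - 1)) <= 3 * freq.
Proof.
move=> c0 d0 /andP[r0 rd].
apply: (@le_trans _ _ (freq * d * (c * flat 2 (c * d - 1)))).
  by rewrite ler_wpM2r// mulr_ge0// flat_ge0.
(* Splitting [c * d] as [(c * d - 1) + 1] turns [flat 2] into [flat 1 + flat 2], free of [c]; the
   constant 3 is [1! + 2!]. *)
have -> : freq * d * (c * flat 2 (c * d - 1)) =
    freq * (flat 1 (c * d - 1) + flat 2 (c * d - 1)).
  by rewrite (flat_shift 1 1) expr1 addn1; ring.
rewrite [leRHS]mulrC ler_wpM2l ?(ltW freq_gt0)//.
have := flat_le_fact 1 (c * d - 1); have := flat_le_fact 2 (c * d - 1).
by rewrite /factorial/=; lra.
Qed.

(** The constant is [1 + 3 + 3]: the cosine term, then one term for the derivative of each cut-off.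
    It does not depend on [n]. *)
Lemma dsin_bump_bound n (y : R) : y \in `]a, b[ -> `|dsin_bump n y| <= 7 * freq.
Proof.
move=> yab; have [s0 s1 s2] := sin_freq_bounds y yab.
move: yab; rewrite in_itv/= => /andP[ay yb].
have ya : 0 <= y - a by rewrite subr_ge0 ltW.
have yb' : 0 <= b - y by rewrite subr_ge0 ltW.
rewrite /dsin_bump; set s := sin _ in s0 s1 s2 *; set c := cos _.
set A := flat 0 (n.+1%:R * (y - a) - 1).
set B := flat 0 (n.+1%:R * (b - y) - 1).
have A0 : 0 <= A := flat_ge0 _ _; have B0 : 0 <= B := flat_ge0 _ _.
have A1 : A <= 1 := flat_le_fact 0 _; have B1 : B <= 1 := flat_le_fact 0 _.
have h1 : 0 <= s * (n.+1%:R * flat 2 (n.+1%:R * (y - a) - 1)) <= 3 * freq.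
  rewrite scaled_flat_bound ?(ltW s0)// andbT.
  by rewrite !mulr_ge0 ?flat_ge0// ltW.
have h2 : 0 <= s * (n.+1%:R * flat 2 (n.+1%:R * (b - y) - 1)) <= 3 * freq.
  rewrite scaled_flat_bound ?(ltW s0)// andbT.
  by rewrite !mulr_ge0 ?flat_ge0// ltW.
move: h1 h2; set p := s * _; set q := s * _ => /andP[p0 p3] /andP[q0 q3].
have -> : freq * c * (A * B) +
    s * (n.+1%:R * flat 2 (n.+1%:R * (y - a) - 1) * B -
         A * (n.+1%:R * flat 2 (n.+1%:R * (b - y) - 1))) =
    freq * c * (A * B) + (p * B - A * q).
  by rewrite /p /q; ring.
have f0 := ltW freq_gt0.
have AB1 : A * B <= 1 by rewrite mulr_ile1.
have h1 : `|freq * c * (A * B)| <= freq.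
  rewrite 2!normrM (ger0_norm f0) (@ger0_norm _ (A * B)) ?mulr_ge0//.
  rewrite -mulrA ler_piMr// mulr_ile1// ?mulr_ge0// cos_max//.
have h2 : `|p * B| <= 3 * freq.
  by rewrite ger0_norm; [apply: le_trans p3; rewrite ler_piMr|exact: mulr_ge0].
have h3 : `|A * q| <= 3 * freq.
  by rewrite ger0_norm; [apply: le_trans q3; rewrite ler_piMl|exact: mulr_ge0].
have := ler_normD (freq * c * (A * B)) (p * B - A * q).
have := ler_normB (p * B) (A * q).
lra.
Qed.

Let cvg_arg (d : R) : 0 < d -> n.+1%:R * d - 1 @[n --> \oo] --> +oo.
Proof.
move=> d0; apply/cvgryPge => M; near=> n.
rewrite lerBrDr -ler_pdivrMr// (@le_trans _ _ n%:R)// ?ler_nat//.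
by near: n; exact: nbhs_infty_ger.
Unshelve. all: by end_near. Qed.

Let cvg_flat0 (d : R) : 0 < d ->
  flat 0 (n.+1%:R * d - 1) @[n --> \oo] --> (1 : R).
Proof. by move=> d0; exact: (cvg_flat 0 _ (cvg_arg d d0)). Qed.

Let cvg_scaled_flat (d : R) : 0 < d ->
  n.+1%:R * flat 2 (n.+1%:R * d - 1) @[n --> \oo] --> (0 : R).
Proof.
move=> d0.
(* Here too [n.+1 * d] is split as [(n.+1 * d - 1) + 1], then divided by [d], which is fixed and
   positive. *)
have -> : (fun n => n.+1%:R * flat 2 (n.+1%:R * d - 1)) =
    (fun n => (flat 1 (n.+1%:R * d - 1) + flat 2 (n.+1%:R * d - 1)) * d^-1).
  apply/funext => n; rewrite (flat_shift 1 1) expr1 addn1.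
  by field; rewrite gt_eqF.
have -> : 0 = (0 ^+ 1 + 0 ^+ 2) * d^-1 by rewrite !expr0n/= addr0 mul0r.
by apply: cvgM; [apply: cvgD; apply: cvg_flat; exact: cvg_arg|exact: cvg_cst].
Qed.

Lemma sin_bump_cvg (y : R) : y \in `]a, b[ ->
  sin_bump n y @[n --> \oo] --> sin (freq * (y - a)).
Proof.
rewrite in_itv/= => /andP[ay yb].
rewrite -[sin (freq * (y - a)) in X in _ --> X]mulr1 -[1 in X in _ --> X]mulr1.
apply: cvgM; first exact: cvg_cst.
by apply: cvgM; apply: cvg_flat0; rewrite subr_gt0.
Qed.

Lemma dsin_bump_cvg (y : R) : y \in `]a, b[ ->
  dsin_bump n y @[n --> \oo] --> freq * cos (freq * (y - a)).
Proof.
rewrite in_itv/= => /andP[ay yb].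
have -> : freq * cos (freq * (y - a)) =
    freq * cos (freq * (y - a)) * (1 * 1) +
    sin (freq * (y - a)) * (0 * 1 - 1 * 0) by ring.
have ya : 0 < y - a by rewrite subr_gt0.
have yb' : 0 < b - y by rewrite subr_gt0.
apply: cvgD; apply: cvgM; try exact: cvg_cst.
  by apply: cvgM; exact: cvg_flat0.
by apply: cvgB; apply: cvgM; first [exact: cvg_flat0|exact: cvg_scaled_flat].
Qed.

End sin_bump.

(** * The strip as a bounded domain, and its area *)

Lemma strip_bounded_domain {R : realType} (a b : R) :
  a < b -> bounded_domain (strip `]a, b[).
Proof.
move=> ab.
have mid : (a + b) / 2 \in `]a, b[ by exact: mid_in_itvoo.
split.
- have /continuousP cs : continuous (@snd (set_type (@unit_circle R)) R).
    by move=> p; exact: cvg_snd.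
  exact/cs/interval_open.
(* Connectedness: the strip is the union of the images of plane segments from [(0, (a + b) / 2)] to
   points [t], all sharing the image of that base point. *)
- pose seg (t : R * R) (r : R) : R * R :=
    (r * t.1, r * (t.2 - (a + b) / 2) + (a + b) / 2).
  have seg_cont t : continuous (seg t).
    have c1 (c d : R) : continuous (fun r : R => r * c + d).
      move=> r; apply: cvgD; last exact: cvg_cst.
      by apply: cvgM; [exact: cvg_id|exact: cvg_cst].
    have c2 (c : R) : continuous (fun r : R => r * c).
      by move=> r; apply: cvgM; [exact: cvg_id|exact: cvg_cst].
    move=> r; exact: (cvg_pair (c2 t.1 r)
      (c1 (t.2 - (a + b) / 2) ((a + b) / 2) r)).
  have -> : strip `]a, b[ = \bigcup_(t in setT `*` `]a, b[)
      (cover_map \o seg t) @` `[0, 1].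
    apply/seteqP; split=> [p pI|_ [[x y] [_ /= yI] [r rI <-]]].
      have [x _ xp] := cover_map_surj p; exists (x, p.2) => //.
      by exists 1; rewrite /= ?in_itv/= ?lexx ?ler01// /seg/= !mul1r subrK.
    move: yI rI mid; rewrite /strip/= !in_itv/= => /andP[ay yb] /andP[r0 r1] _.
    by apply/andP; split; nra.
  apply: bigcup_connected.
    exists (cover_map (0, (a + b) / 2)) => t _; exists 0.
      by rewrite /= in_itv/= lexx ler01.
    by rewrite /seg /= !mul0r add0r.
  move=> t _; apply: connected_continuous_connected.
    by apply/connected_intervalP; exact: interval_is_interval.
  apply: continuous_subspaceT => r.
  by apply: continuous_comp; [exact: seg_cont|exact: cover_map_continuous].
- by exists (cover_map (0, (a + b) / 2)).
- exists (Num.max `|a| `|b|) => p; rewrite /strip/= in_itv/= => /andP[ap pb].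
  rewrite le_max; have [p0|p0] := leP 0 p.2; apply/orP; [right|left].
    by rewrite ger0_norm// (le_trans (ltW pb))// ler_norm.
  by rewrite ltr0_norm// -normrN (le_trans _ (ler_norm _))// lerN2 ltW.
Qed.

Lemma area_strip {R : realType} (a b : R) : a < b ->
  area (strip `]a, b[) = (2 * pi * (b - a))%:E.
Proof. by move=> ab; rewrite /area fund_patch_strip leb2_patch. Qed.

(** * The eigenfunction and the bound on the first eigenvalue *)

Section eigenfunction.
Context {R : realType} (a b : R).
Hypothesis ab : a < b.

Let freq := freq a b.
Let eigf (p : cylinder R) : R := sin (freq * (p.2 - a)).
Let gy (t : R * R) : R := freq * cos (freq * (t.2 - a)).

Let test_function_sin_bump n :
  test_function (strip `]a, b[) (fun p : cylinder R => sin_bump a b n p.2).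
Proof.
split.
  move=> k; apply: (Ck_comp_snd k (sin_bump a b n)) => m.
  exact: iter_derivable_sin_bump.
have n0 : 0 < n.+1%:R^-1 :> R by rewrite invr_gt0.
(* Outside this compact set the distance to one end is at most [1 / (n + 1)], so the corresponding
   cut-off vanishes. *)
exists (cover_map @` (`[0, 2 * pi] `*` `[a + n.+1%:R^-1, b - n.+1%:R^-1])).
split.
- apply: continuous_compact.
    by apply: continuous_subspaceT; exact: cover_map_continuous.
  by apply: compact_setX; exact: segment_compact.
- move=> _ [[x y] [_ /=] + <-]; rewrite /strip/= !in_itv/= => /andP[ay yb].
  by rewrite (lt_le_trans _ ay) ?ltrDl// (le_lt_trans yb)// gtrBl.
- move=> p Kp; rewrite /sin_bump.
  have flat0 (d : R) : d <= n.+1%:R^-1 -> flat 0 (n.+1%:R * d - 1) = 0.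
    rewrite -[n.+1%:R^-1]mul1r ler_pdivlMr// mulrC => dn.
    by rewrite /flat ifF//; apply/negbTE; rewrite -leNgt subr_le0.
  have [pa|ap] := leP p.2 (a + n.+1%:R^-1).
    by rewrite flat0 ?mul0r ?mulr0// lerBlDl.
  have [bp|pb] := leP (b - n.+1%:R^-1) p.2.
    by rewrite (flat0 (b - p.2)) ?mulr0// lerBlDl addrC -lerBlDl.
  exfalso; apply: Kp; have [x xI xp] := cover_map_surj p.
  by exists (x, p.2) => //; split => //=; rewrite in_itv/= !ltW.
Qed.

Let dx_sin_bump n : dx (fun p : cylinder R => sin_bump a b n p.2) = cst 0.
Proof.
apply/funext => z; apply/derive_val.
exact: (is_derive_fst_comp_snd (sin_bump a b n) z).
Qed.

Let dy_sin_bump n :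
  dy (fun p : cylinder R => sin_bump a b n p.2) = dsin_bump a b n \o snd.
Proof.
apply/funext => z.
have d := (is_derive_snd (sin_bump a b n \o snd) z _).2
  (is_derive_sin_bump a b n z.2).
exact: (@derive_val _ _ _ _ _ _ _ d).
Qed.

Let continuous_eigf : continuous (eigf \o cover_map).
Proof. exact: (continuous_comp_snd _ _ (is_derive_sin_freq a b)). Qed.

Let continuous_gy : continuous gy.
Proof. exact: (continuous_comp_snd _ _ (is_derive_cos_freq a b)). Qed.

Let H10_eigf : H10 (strip `]a, b[) eigf (cst 0) gy.
Proof.
split.
- exact: continuous_L2_strip ab continuous_eigf.
- by apply: continuous_L2_strip ab _; exact: cst_continuous.
- exact: continuous_L2_strip ab continuous_gy.
exists (fun n (p : cylinder R) => sin_bump a b n p.2); split.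
- exact: test_function_sin_bump.
- apply: (L2_cvg_dominated a b 1) => //.
  + by move=> n; exact: (continuous_comp_snd _ _ (is_derive_sin_bump a b n)).
  + by move=> n t [_ t2]; exact: sin_bump_bound.
  + by move=> t [_ t2]; exact: sin_bump_cvg.
- apply: (L2_cvg_dominated a b 0) => //.
  + by move=> n; rewrite dx_sin_bump; exact: cst_continuous.
  + exact: cst_continuous.
  + by move=> n t _; rewrite dx_sin_bump normr0.
  + by move=> t _; under eq_fun do rewrite dx_sin_bump; exact: cvg_cst.
- apply: (L2_cvg_dominated a b (7 * freq)) => //.
  (* Continuity of the axial derivative is read off from the test function being of class C^1. *)
  + move=> n; have [/(_ 1%N)[_ [_ [_ [cdy _]]]] _] := test_function_sin_bump n.
    exact: cdy.
  + by move=> n t [_ t2]; rewrite dy_sin_bump; exact: dsin_bump_bound.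
  + move=> t [_ t2]; under eq_fun do rewrite dy_sin_bump.
    exact: dsin_bump_cvg.
Qed.

(* Integrate the [y]-derivative of [gy * phi] over each vertical segment. *)
Let weak_eigen phi : test_function (strip `]a, b[) phi ->
  \int[leb2]_(t in fund_patch (strip `]a, b[))
    (cst 0 t * dx phi t + gy t * dy phi t) =
  \int[leb2]_(t in fund_patch (strip `]a, b[))
    (freq ^+ 2 * eigf (cover_map t) * phi (cover_map t)).
Proof.
move=> [Cphi [K [_ KI phiK]]]; rewrite fund_patch_strip.
have [cphi [dphi [_ [cdy _]]]] := Cphi 1%N.
set D := `[0, 2 * pi[ `*` `]a, b[.
pose f1 (t : R * R) := gy t * dy phi t.
pose f2 (t : R * R) := freq ^+ 2 * eigf (cover_map t) * phi (cover_map t).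
have cf1 : continuous f1.
  by move=> t; apply: cvgM; [exact: continuous_gy|exact: cdy].
have cf2 : continuous f2.
  move=> t; apply: cvgM; last exact: cphi.
  by apply: cvgM; [exact: cvg_cst|exact: continuous_eigf].
have cf12 : continuous (fun t => f1 t - f2 t).
  by move=> t; apply: cvgB; [exact: cf1|exact: cf2].
have i1 := continuous_integrable_patch a b f1 ab cf1.
have i2 := continuous_integrable_patch a b f2 ab cf2.
have i12 := continuous_integrable_patch a b _ ab cf12.
under eq_Rintegral do rewrite mul0r add0r.
apply/eqP; rewrite -subr_eq0; apply/eqP.
transitivity (\int[leb2]_(t in D) (f1 t - f2 t)).
  by rewrite [RHS]RintegralB//; exact: measurable_rectangle.
(* The support of [phi] lies in the open strip, so [phi] vanishes at heights [a] and [b]; this kills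
   the boundary terms. *)
have phi0 x y : y = a \/ y = b -> phi (cover_map (x, y)) = 0.
  move=> yab; apply: phiK => /KI; rewrite /strip/= in_itv/=.
  by case: yab => ->; rewrite ltxx ?andbF.
have line x : (\int[lebesgue_measure]_(y in `]a, b[)
    (f1 (x, y) - f2 (x, y))%:E = 0)%E.
  have cpair : continuous (fun y : R => (x, y) : R * R).
    move=> y; exact: (cvg_pair (@cvg_cst _ x _ _ _) (@cvg_id _ _)).
  have cl : continuous (fun y => f1 (x, y) - f2 (x, y)).
    by move=> y; exact: (continuous_comp (cpair y) (cf12 _)).
  have ml (i : interval R) :
      measurable_fun [set` i] (fun y => (f1 (x, y) - f2 (x, y))%:E).
    apply/measurable_EFinP/measurable_funTS.
    exact: continuous_measurable_fun.
  (* Adding the endpoints, a null set, gives the closed segment on which the fundamental theorem of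
     calculus is applied to [F]. *)
  rewrite integral_itv_bndo_bndc// integral_itv_obnd_cbnd//.
  pose F y := gy (x, y) * phi (cover_map (x, y)).
  have dF (y : R) : is_derive y 1 F (f1 (x, y) - f2 (x, y)).
    have dphiy : is_derive (x, y) (0, 1) (phi \o cover_map) (dy phi (x, y)).
      by apply: DeriveDef => //; have [] := dphi (x, y).
    have := is_deriveM (is_derive_cos_freq a b y)
      ((is_derive_snd _ _ _).1 dphiy).
    by congr is_derive; rewrite /f1 /f2 /gy /eigf /GRing.scale/= -/freq; ring.
  rewrite (continuous_FTC2 (F := F)) //.
  + rewrite /F (phi0 x b (or_intror erefl)) (phi0 x a (or_introl erefl)).
    by rewrite !mulr0 sube0.
  + exact: continuous_subspaceT.
  + have cF : continuous F.
      move=> y; apply/differentiable_continuous/derivable1_diffP.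
      by have [] := dF y.
    split; first by move=> y _; have [] := dF y.
      by apply: cvg_at_right_filter; exact: cF.
    by apply: cvg_at_left_filter; exact: cF.
  + by move=> y _; rewrite derive1E; exact: derive_val.
rewrite /Rintegral integral_mkcond -[RHS]/(fine (0%:E : \bar R)); congr fine.
(* Fubini on the whole plane, with the integrand extended by zero outside [D]; each inner integral
   is then zero, by [line] when [x] lies in the period. *)
transitivity (\int[lebesgue_measure]_x \int[lebesgue_measure]_y
  (((fun t => (f1 t - f2 t)%:E) \_ D) (x, y)))%E.
  apply/esym/integral12_prod_meas1; apply/(integrable_mkcond _ _).1 => //.
  exact: measurable_rectangle.
apply: integral0_eq => x _.
have [xI|xI] := boolP (x \in `[0, 2 * pi[); last first.
  apply: integral0_eq => y _; rewrite patchE memNset// => -[/= xI' _].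
  by rewrite xI' in xI.
rewrite -[RHS](line x) [RHS]integral_mkcond; apply: eq_integral => y _.
rewrite !patchE; congr (if _ then _ else _).
by apply/idP/idP => /set_mem; [case=> _ yI|move=> yI]; apply/mem_set.
Qed.

Lemma eigf_eigenspace : dirichlet_eigenspace (strip `]a, b[) (freq ^+ 2) eigf.
Proof.
split.
  apply: continuous_L2_strip => // t.
  by apply: cvgM; [exact: cvg_cst|exact: continuous_eigf].
by exists (cst 0), gy; split; [exact: H10_eigf|exact: weak_eigen].
Qed.

Lemma dirichlet_eigenvalue1_strip :
  (dirichlet_eigenvalue (strip `]a, b[) 1 <= (freq ^+ 2)%:E)%E.
Proof.
apply: ereal_inf_lbound; exists (freq ^+ 2) => //.
exists (fun=> freq ^+ 2), (fun=> eigf); split.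
  by move=> i; split => //; exact: eigf_eigenspace.
move=> c c0 i; apply: contrapT => /eqP ci0.
have mP : measurable (fund_patch (strip `]a, b[) :
    set (measurableTypeR R * measurableTypeR R)).
  by rewrite fund_patch_strip; exact: measurable_rectangle.
(* If a nonzero multiple of the sine vanished almost everywhere, the whole patch would be null, as
   the sine is positive there; but its area is positive. *)
have : leb2 (fund_patch (strip `]a, b[)) = 0%E.
  apply/negligibleP => //; apply: negligibleS c0 => t Pt /= /(_ Pt).
  rewrite big_ord1; have -> : ord0 = i :> 'I_1 by exact/esym/ord1.
  move=> /eqP; rewrite mulf_eq0 (negbTE ci0)/= => /eqP s0.
  move: Pt; rewrite fund_patch_strip => -[_ /(sin_freq_bounds a b ab)[]].
  by rewrite -/freq /eigf/= in s0 *; rewrite s0 ltxx.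
rewrite fund_patch_strip leb2_patch// => -[] /eqP; apply/negP.
by rewrite gt_eqF// !mulr_gt0 ?pi_gt0// subr_gt0.
Qed.

End eigenfunction.

(** * Comparison of the first eigenvalue with the area *)

Theorem proposition2p1 (R : realType) :
  (forall C : R, 0 < C ->
     exists Omega : set (cylinder R),
       bounded_domain Omega /\
       (dirichlet_eigenvalue Omega 1 < (4 * C * pi / fine (area Omega))%:E)%E) /\
  (forall a h : R, pi ^+ 2 / 2 < h ->
     ~ satisfies_polya (strip `]a, a + h[)).
Proof.
have pi2 : 0 < pi ^+ 2 / 2 :> R by rewrite divr_gt0// exprn_gt0// pi_gt0.
(* Both claims are instances of this comparison: the first takes a height above the threshold for
   [C], the second takes [C = 1]. *)
have small (C a h : R) : 0 < C -> pi ^+ 2 / 2 / C < h ->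
    (dirichlet_eigenvalue (strip `]a, (a + h)%R[) 1 <
     (4 * C * pi / fine (area (strip `]a, (a + h)%R[)))%:E)%E.
  move=> C0 Ch; have h0 : 0 < h by rewrite (lt_trans _ Ch)// divr_gt0.
  have ah : a < a + h by rewrite ltrDl.
  apply: le_lt_trans (dirichlet_eigenvalue1_strip a (a + h) ah) _.
  rewrite area_strip//= lte_fin /freq addrAC subrr add0r.
  have -> : 4 * C * pi / (2 * pi * h) = 2 * C / h.
    have pi0 : pi != 0 :> R by rewrite gt_eqF// pi_gt0.
    by move: (pi : R) pi0 => p p0; field; rewrite p0 gt_eqF.
  rewrite expr_div_n expr2 invfM mulrA ltr_pM2r ?invr_gt0// ltr_pdivrMr//.
  move: Ch; rewrite ltr_pdivrMr// ltr_pdivrMr// => Ch.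
  by rewrite (lt_le_trans Ch)//; lra.
split=> [C C0|a h hpi polya].
  exists (strip `]0, 0 + (pi ^+ 2 / 2 / C + 1)[); split.
    by apply: strip_bounded_domain; rewrite ltrDl ltr_wpDl// divr_ge0// ltW.
  by apply: small => //; rewrite ltrDl.
(* Already the case [k = 1] of the conjectured inequality fails. *)
have := polya 1%N isT; rewrite leNgt => /negP; apply.
have := small 1 a h ltr01; rewrite divr1 => /(_ hpi).
by rewrite !mulr1.
Qed.
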